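(* $$\frac{256\sqrt3}{9}=\sum_{j=0}^{\infty}\left(-\frac14\right)^{j}\frac{\left(-\frac1{12}\right)_j\left(\frac5{12}\right)_j\left(\frac56\right)_j}{(1)_j\left(\frac53\right)_j\left(\frac53\right)_j}\,(60j+49).$$
   Context: $(x)_0=1$ and $(x)_j=x(x+1)\cdots(x+j-1)$ for positive integers $j$ (rising factorial). *)

(* Defs.v *)
From Stdlib Require Import Reals.
From Coquelicot Require Import Coquelicot.
Open Scope R_scope.

(* Rising factorial (x)_j = x (x+1) ... (x+j-1), with (x)_0 = 1. *)
Fixpoint rising (x : R) (j : nat) : R :=
  match j with
  | O => 1
  | S k => rising x k * (x + INR k)
  end.

(* Main.v *)
Require Import Defs.
From Stdlib Require Import Reals Lra Lia Factorial.
From Coquelicot Require Import Coquelicot.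
Open Scope R_scope.

(** The series is the member m = 0 of a family of series indexed by m whose
    sum does not depend on m, and which degenerates to its first term as m
    tends to infinity.

    The family comes from the alternating well-poised term
    [(-1)^k (a+2k) (b)_k (c)_k (e)_k / ((1+a-b)_k (1+a-c)_k (1+a-e)_k)], whose
    sum over [k >= 0] has a closed form in Gamma functions when [b = a]. With
    the corresponding Gamma factors it becomes F such that each integer shift of
    [a], [b], [c], [e] changes it, up to sign, by a difference in k of a
    hypergeometric term G. The value at [k = 0] of the G that belongs to the
    move [(a, e) -> (a+2, e+1)], taken after n such moves, is the summand of an
    accelerated series, with ratio tending to -1/4. Starting from
    [a = b = 3/2 + m], [c = 7/6] and [e = 5/6], it is [summand n m] below, up to
    a constant factor. At [m = 0] its polynomial part factors as
    [(n + 1/2) (6n + 1) (60n + 49) / 36], and the remaining factors cancel so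
    that 96 times it is the given term ([term_summand]).

    Shifting [a] and [b] together, that is m, changes [summand n m] by a
    difference in n of [2 n kernel n m] ([wz_identity]). This vanishes at
    [n = 0] and as n tends to infinity, so the sum is independent of m
    ([Series_summand_const]). The part of the sum over [n >= 1] is bounded by [16 / (m + 1)]
    ([Series_summand_near_head]), hence the sum is the limit of [summand 0 m].
    That limit is a Gamma quotient, [4/9] times the limit of
    [(1/2)_m^2 / ((1/3)_m (2/3)_m)]. The latter equals
    [(2m)!^2 27^m / (16^m m! (3m)!)], and Stirling's formula, whose constant
    cancels, gives [2 / sqrt 3] ([is_lim_seq_rising_ratio]). Altogether
    [96 * (4/9) * 2 / sqrt 3 = 256 sqrt 3 / 9]. *)

(** * The Wilf-Zeilberger pair *)

Lemma rising_pos (x : R) (n : nat) : 0 < x -> 0 < rising x n.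
Proof.
  intros Hx; induction n as [|n IH]; simpl; [lra|].
  apply Rmult_lt_0_compat; [exact IH|]. pose proof (pos_INR n); lra.
Qed.

(** The hypergeometric part of the accelerated summand. Here [rising 1 (2 * n)]
    is [(2n)!]; the products in which n and m occur together are kept as single
    rising factorials so that both shifts give rational quotients. *)
Definition kernel (n m : nat) : R :=
  (-1) ^ n * (rising (5 / 6) n * rising (- (1 / 6)) (2 * n) * rising (1 / 6) n)
  / rising 1 (2 * n)
  * (rising (1 / 2) (m + n) * rising (3 / 2) m)
  / (rising (4 / 3) (m + 2 * n) * rising (5 / 3) (m + n)).

(** With [a = 3/2 + m + 2n], [b = 3/2 + m], [c = 7/6] and [e = 5/6 + n], the
    polynomial factor is
    [(1+2a-b-c-e) (1+a-b) (1+a-c) - (1+a-b-c) (1+a-b-e) (1+a-c-e)]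
    and the denominator is [(1+a-b) (1+a-c)]. *)
Definition summand (n m : nat) : R :=
  kernel n m
  * ((3 * INR n + INR m + 1 / 2) * (2 * INR n + 1) * (2 * INR n + INR m + 4 / 3)
     - (2 * INR n - 1 / 6) * (INR n + 1 / 6) * (INR n + INR m + 1 / 2))
  / ((2 * INR n + 1) * (2 * INR n + INR m + 4 / 3)).

(** The quotient of consecutive kernels in n, on real arguments to make its
    bounds statements about rational functions. *)
Definition step (n m : R) : R :=
  - ((n + 5 / 6) * (2 * n - 1 / 6) * (2 * n + 5 / 6) * (n + 1 / 6) * (n + m + 1 / 2))
  / ((2 * n + 1) * (2 * n + 2)
     * ((2 * n + m + 4 / 3) * (2 * n + m + 7 / 3) * (n + m + 5 / 3))).

Ltac INR_nonneg :=
  repeat match goal with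
  | |- context [INR ?n] =>
      lazymatch goal with H : 0 <= INR n |- _ => fail | _ => pose proof (pos_INR n) end
  end.

Lemma kernel_S_l (n m : nat) : kernel (S n) m = kernel n m * step (INR n) (INR m).
Proof.
  unfold kernel, step.
  replace (2 * S n)%nat with (S (S (2 * n))) by lia.
  replace (m + S n)%nat with (S (m + n)) by lia.
  replace (m + S (S (2 * n)))%nat with (S (S (m + 2 * n))) by lia.
  cbn [rising pow].
  repeat (rewrite S_INR || rewrite plus_INR || rewrite mult_INR).
  cbn [INR].
  pose proof (rising_pos 1 (2 * n) ltac:(lra)).
  pose proof (rising_pos (4 / 3) (m + 2 * n) ltac:(lra)).
  pose proof (rising_pos (5 / 3) (m + n) ltac:(lra)).
  INR_nonneg. field. repeat split; lra.
Qed.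

Lemma kernel_S_r (n m : nat) :
  kernel n (S m) = kernel n m
    * ((INR n + INR m + 1 / 2) * (INR m + 3 / 2)
       / ((2 * INR n + INR m + 4 / 3) * (INR n + INR m + 5 / 3))).
Proof.
  unfold kernel.
  replace (S m + n)%nat with (S (m + n)) by lia.
  replace (S m + 2 * n)%nat with (S (m + 2 * n)) by lia.
  cbn [rising].
  repeat (rewrite plus_INR || rewrite mult_INR).
  cbn [INR].
  pose proof (rising_pos 1 (2 * n) ltac:(lra)).
  pose proof (rising_pos (4 / 3) (m + 2 * n) ltac:(lra)).
  pose proof (rising_pos (5 / 3) (m + n) ltac:(lra)).
  INR_nonneg. field. repeat split; lra.
Qed.

(** The certificate [2 n kernel n m] is the value at [k = 0] of the
    antidifference G belonging to the shift [(a, b) -> (a + 1, b + 1)]; its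
    factor [2 n] is [a - b], and makes it vanish at [n = 0]. *)
Lemma wz_identity (n m : nat) :
  summand n (S m) - summand n m
  = 2 * INR (S n) * kernel (S n) m - 2 * INR n * kernel n m.
Proof.
  unfold summand. rewrite kernel_S_l, kernel_S_r, !S_INR. unfold step.
  INR_nonneg. field. repeat split; lra.
Qed.

(** At [m = 0] the factor [(1/6)_n (6n + 1)] is absorbed by half of the
    duplicated [(4/3)_(2n+1)], and [(1/2)_n / (2n)!] is [1 / (4^n n!)]. Apart
    from the factor [60 j + 49], both sides satisfy the same first-order
    recurrence with rational coefficients, so an induction replaces the
    duplication formulas. *)
Lemma term_summand (j : nat) :
  (- (1 / 4)) ^ j
       * ((rising (- (1 / 12)) j * rising (5 / 12) j * rising (5 / 6) j)
          / (rising 1 j * rising (5 / 3) j * rising (5 / 3) j))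
       * (60 * INR j + 49) = 96 * summand j 0.
Proof.
  assert (E : (- (1 / 4)) ^ j
       * ((rising (- (1 / 12)) j * rising (5 / 12) j * rising (5 / 6) j)
          / (rising 1 j * rising (5 / 3) j * rising (5 / 3) j))
     = kernel j 0 * (4 / 3) * (6 * INR j + 1) / (2 * INR j + 4 / 3)).
  { induction j as [|j IH].
    - unfold kernel; simpl; field.
    - rewrite kernel_S_l. unfold step.
      (* Solving the hypothesis for the kernel keeps its own rising factorials
         out of the equation. *)
      replace (kernel j 0) with
        ((- (1 / 4)) ^ j
         * ((rising (- (1 / 12)) j * rising (5 / 12) j * rising (5 / 6) j)
          / (rising 1 j * rising (5 / 3) j * rising (5 / 3) j))
         * (2 * INR j + 4 / 3) / ((4 / 3) * (6 * INR j + 1)))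
        by (rewrite IH; INR_nonneg; field; split; lra).
      clear IH. cbn [rising pow]. rewrite S_INR. cbn [INR].
      pose proof (rising_pos 1 j ltac:(lra)).
      pose proof (rising_pos (5 / 3) j ltac:(lra)).
      INR_nonneg. field. repeat split; lra. }
  rewrite E. unfold summand. cbn [INR]. INR_nonneg. field. split; lra.
Qed.

(** * Bounds and the decay of the tail *)

Lemma Rabs_div_le (a b c : R) : 0 < b -> Rabs a <= c * b -> Rabs (a / b) <= c.
Proof.
  intros Hb H. rewrite Rabs_div by lra. rewrite (Rabs_pos_eq b) by lra.
  apply Rle_div_l; lra.
Qed.

Lemma Rabs_mult_le (a b c d : R) :
  Rabs a <= c -> Rabs b <= d -> Rabs (a * b) <= c * d.
Proof.
  intros Ha Hb. rewrite Rabs_mult.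
  apply Rmult_le_compat; auto using Rabs_pos.
Qed.

(** Three of the factors pair off into quotients of absolute value at most 1.
    What remains gives both the rate 1/4 and, at [n = 0], the decay in m. *)
Lemma step_bound (n m : R) : 0 <= n -> 0 <= m ->
  Rabs (step n m)
  <= (n + 5 / 6) * (n + 1 / 6) / ((2 * n + m + 4 / 3) * (2 * n + m + 7 / 3)).
Proof.
  intros Hn Hm.
  replace (step n m) with
    ((2 * n - 1 / 6) / (2 * n + 1) * ((2 * n + 5 / 6) / (2 * n + 2))
     * ((n + m + 1 / 2) / (n + m + 5 / 3))
     * (- ((n + 5 / 6) * (n + 1 / 6)) / ((2 * n + m + 4 / 3) * (2 * n + m + 7 / 3))))
    by (unfold step; field; repeat split; lra).
  apply Rle_trans with (1 * 1 * 1
     * ((n + 5 / 6) * (n + 1 / 6) / ((2 * n + m + 4 / 3) * (2 * n + m + 7 / 3))));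
    [|lra].
  apply Rabs_mult_le.
  - repeat apply Rabs_mult_le; (apply Rabs_div_le; [lra|apply Rabs_le; lra]).
  - rewrite Rdiv_opp_l, Rabs_Ropp, Rabs_pos_eq; [lra|].
    apply Rle_div_r; nra.
Qed.

Lemma kernel_0_bound (m : nat) : 0 < kernel 0 m <= 1.
Proof.
  induction m as [|m IH].
  - unfold kernel; simpl; lra.
  - rewrite kernel_S_r. cbn [INR]. pose proof (pos_INR m).
    set (q := _ / _).
    assert (0 < q <= 1).
    { unfold q; split; [apply Rdiv_lt_0_compat; nra|].
      apply Rle_div_l; nra. }
    split; [apply Rmult_lt_0_compat; lra|].
    replace 1 with (1 * 1) by ring. apply Rmult_le_compat; lra.
Qed.

Lemma step_le_quarter (n m : nat) : Rabs (step (INR n) (INR m)) <= 1 / 4.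
Proof.
  pose proof (pos_INR n); pose proof (pos_INR m).
  eapply Rle_trans; [apply step_bound; assumption|].
  apply Rle_div_l; nra.
Qed.

Lemma kernel_bound (n m : nat) : Rabs (kernel n m) <= (1 / 4) ^ n.
Proof.
  induction n as [|n IH].
  - pose proof (kernel_0_bound m). simpl. apply Rabs_le; lra.
  - rewrite kernel_S_l. cbn [pow]. rewrite Rmult_comm.
    apply Rabs_mult_le; [apply step_le_quarter|exact IH].
Qed.

(** The first step already costs [1 / (m + 1)^2], against a polynomial factor
    growing only like m: this is why the tail disappears in the limit. *)
Lemma kernel_tail_bound (n m : nat) :
  Rabs (kernel (S n) m) <= (1 / 4) ^ n * / (INR m + 1) ^ 2.
Proof.
  induction n as [|n IH].
  - rewrite kernel_S_l. apply Rabs_mult_le.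
    + pose proof (kernel_0_bound m). simpl. apply Rabs_le; lra.
    + pose proof (pos_INR m). cbn [INR].
      eapply Rle_trans; [apply step_bound; lra|].
      apply Rle_trans with (1 / (INR m + 1) ^ 2);
        [|unfold Rdiv; lra].
      apply Rle_div_l; [nra|].
      replace (1 / (INR m + 1) ^ 2 * _) with
        (((2 * 0 + INR m + 4 / 3) * (2 * 0 + INR m + 7 / 3)) / (INR m + 1) ^ 2)
        by (field; lra).
      apply (Rle_div_r _ _ ((INR m + 1) ^ 2)); [apply pow_lt; lra|nra].
  - rewrite kernel_S_l. cbn [pow]. rewrite Rmult_comm, Rmult_assoc.
    apply Rabs_mult_le; [apply step_le_quarter|exact IH].
Qed.

Lemma summand_le_kernel (n m : nat) :
  Rabs (summand n m) <= Rabs (kernel n m) * (4 * INR n + INR m + 1).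
Proof.
  pose proof (pos_INR n); pose proof (pos_INR m).
  replace (summand n m) with
    (kernel n m * ((3 * INR n + INR m + 1 / 2)
      - (2 * INR n - 1 / 6) / (2 * INR n + 1)
        * ((INR n + INR m + 1 / 2) / (2 * INR n + INR m + 4 / 3))
        * (INR n + 1 / 6)))
    by (unfold summand; field; split; lra).
  apply Rabs_mult_le; [apply Rle_refl|].
  assert (E : Rabs ((2 * INR n - 1 / 6) / (2 * INR n + 1)
        * ((INR n + INR m + 1 / 2) / (2 * INR n + INR m + 4 / 3))
        * (INR n + 1 / 6)) <= 1 * 1 * (INR n + 1 / 6)).
  { repeat apply Rabs_mult_le;
      try (apply Rabs_div_le; [lra|]); apply Rabs_le; lra. }
  apply Rabs_le_between in E. apply Rabs_le. lra.
Qed.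

Lemma INR_succ_le_pow2 (n : nat) : INR n + 1 <= 2 ^ n.
Proof.
  induction n as [|n IH]; [simpl; lra|].
  rewrite S_INR; cbn [pow]; pose proof (pos_INR n); lra.
Qed.

Lemma half_pow (n : nat) : (1 / 4) ^ n * 2 ^ n = (1 / 2) ^ n.
Proof. rewrite <- Rpow_mult_distr. f_equal. lra. Qed.

Lemma summand_tail_bound (n m : nat) :
  Rabs (summand (S n) m) <= 8 / (INR m + 1) * (1 / 2) ^ n.
Proof.
  pose proof (pos_INR n); pose proof (pos_INR m); pose proof (INR_succ_le_pow2 n).
  eapply Rle_trans; [apply summand_le_kernel|].
  eapply Rle_trans.
  { apply Rmult_le_compat_r; [rewrite S_INR; lra|apply kernel_tail_bound]. }
  replace (8 / (INR m + 1) * (1 / 2) ^ n)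
    with ((1 / 4) ^ n * / (INR m + 1) ^ 2 * (8 * (INR m + 1) * 2 ^ n))
    by (rewrite <- half_pow; field; lra).
  apply Rmult_le_compat_l.
  - apply Rmult_le_pos; [apply pow_le; lra|].
    apply Rlt_le, Rinv_0_lt_compat, pow_lt; lra.
  - rewrite S_INR. nra.
Qed.

Lemma ex_series_half (c : R) : ex_series (fun n => c * (1 / 2) ^ n).
Proof.
  apply (ex_series_scal c (fun n => (1 / 2) ^ n)).
  apply ex_series_geom. apply Rabs_lt_between; lra.
Qed.

Lemma ex_series_summand (m : nat) : ex_series (fun n => summand n m).
Proof.
  apply ex_series_incr_1.
  apply (ex_series_le (fun n => summand (S n) m)
           (fun n => 8 / (INR m + 1) * (1 / 2) ^ n)).
  - intros n. apply summand_tail_bound.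
  - apply ex_series_half.
Qed.

Lemma Series_summand_near_head (m : nat) :
  Rabs (Series (fun n => summand n m) - summand 0 m) <= 16 / (INR m + 1).
Proof.
  rewrite (Series_incr_1 _ (ex_series_summand m)).
  replace (_ + _ - _) with (Series (fun n => summand (S n) m)) by ring.
  pose proof (pos_INR m).
  replace (16 / (INR m + 1))
    with (Series (fun n => 8 / (INR m + 1) * (1 / 2) ^ n)).
  2: { rewrite Series_scal_l, Series_geom by (apply Rabs_lt_between; lra).
       field; lra. }
  eapply Rle_trans; [apply Series_Rabs|apply Series_le].
  - apply (ex_series_le (fun n => Rabs (summand (S n) m))
             (fun n => 8 / (INR m + 1) * (1 / 2) ^ n)).
    + intros n. unfold norm; simpl. unfold abs; simpl. rewrite Rabs_Rabsolu.
      apply summand_tail_bound.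
    + apply ex_series_half.
  - intros n. split; [apply Rabs_pos|apply summand_tail_bound].
  - apply ex_series_half.
Qed.

(** * Independence of the parameter *)

Lemma is_series_telescope (f : nat -> R) (l : R) :
  is_lim_seq f l -> is_series (fun n => f (S n) - f n) (l - f 0%nat).
Proof.
  intros Hf.
  change (is_lim_seq (sum_n (fun n => f (S n) - f n)) (Finite (l - f 0%nat))).
  apply (is_lim_seq_ext (fun n => f (S n) - f 0%nat)).
  - intros n. induction n as [|n IH].
    + now rewrite sum_O.
    + rewrite sum_Sn, <- IH. unfold plus; simpl. ring.
  - apply is_lim_seq_minus'; [|apply is_lim_seq_const].
    now apply is_lim_seq_incr_1 in Hf.
Qed.

Lemma certificate_vanishes (m : nat) :
  is_lim_seq (fun n => 2 * INR n * kernel n m) 0.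
Proof.
  apply is_lim_seq_abs_0.
  apply (is_lim_seq_le_le (fun _ => 0) _ (fun n => 2 * (1 / 2) ^ n)).
  - intros n. split; [apply Rabs_pos|].
    pose proof (pos_INR n); pose proof (INR_succ_le_pow2 n).
    rewrite <- half_pow, (Rmult_comm ((1 / 4) ^ n)), <- Rmult_assoc.
    apply Rabs_mult_le; [apply Rabs_le; lra|apply kernel_bound].
  - apply is_lim_seq_const.
  - replace (Finite 0) with (Rbar_mult 2 0) by (simpl; f_equal; ring).
    apply is_lim_seq_scal_l, is_lim_seq_geom. apply Rabs_lt_between; lra.
Qed.

Lemma Series_summand_const (m : nat) :
  Series (fun n => summand n m) = Series (fun n => summand n 0).
Proof.
  induction m as [|m IH]; [reflexivity|]. rewrite <- IH.
  apply Rminus_diag_uniq.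
  rewrite <- Series_minus by apply ex_series_summand.
  rewrite (Series_ext _ _ (fun n => wz_identity n m)).
  apply is_series_unique.
  replace 0 with (0 - 2 * INR 0 * kernel 0 m) by (simpl; ring).
  apply (is_series_telescope (fun n => 2 * INR n * kernel n m)).
  apply certificate_vanishes.
Qed.

(** * Stirling's formula with an unknown constant *)

(** With the next lemma, the two bounds that make the increments of
    [stirling_error] nonpositive and summable: at [x = 1/n] they read
    [1 <= (n + 1/2) ln (1 + 1/n) <= 1 + 1/(4n) - 1/(4(n+1))]. *)
Lemma ln_lower (x : R) : 0 <= x -> 2 * x / (2 + x) <= ln (1 + x).
Proof.
  intros Hx.
  destruct (MVT_gen (fun t => ln (1 + t) - 2 * t / (2 + t)) 0 x
    (fun t => t ^ 2 / ((1 + t) * (2 + t) ^ 2))) as [c [Hc E]].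
  - intros t Ht. rewrite Rmin_left, Rmax_right in Ht by lra.
    auto_derive; [lra|]. field; lra.
  - intros t Ht. rewrite Rmin_left, Rmax_right in Ht by lra.
    apply derivable_continuous_pt.
    exists (t ^ 2 / ((1 + t) * (2 + t) ^ 2)). apply is_derive_Reals.
    auto_derive; [lra|]. field; lra.
  - rewrite Rmin_left, Rmax_right in Hc by lra.
    replace (1 + 0) with 1 in E by ring. rewrite ln_1 in E.
    assert (0 <= c ^ 2 / ((1 + c) * (2 + c) ^ 2)).
    { apply Rle_div_r; nra. }
    replace (2 * 0 / (2 + 0)) with 0 in E by field.
    assert (0 <= c ^ 2 / ((1 + c) * (2 + c) ^ 2) * (x - 0)) by nra.
    lra.
Qed.

Lemma ln_upper (x : R) : 0 <= x -> ln (1 + x) <= x * (2 + x) / (2 * (1 + x)).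
Proof.
  intros Hx.
  destruct (MVT_gen (fun t => t * (2 + t) / (2 * (1 + t)) - ln (1 + t)) 0 x
    (fun t => t ^ 2 / (2 * (1 + t) ^ 2))) as [c [Hc E]].
  - intros t Ht. rewrite Rmin_left, Rmax_right in Ht by lra.
    auto_derive; [lra|]. field; lra.
  - intros t Ht. rewrite Rmin_left, Rmax_right in Ht by lra.
    apply derivable_continuous_pt.
    exists (t ^ 2 / (2 * (1 + t) ^ 2)). apply is_derive_Reals.
    auto_derive; [lra|]. field; lra.
  - rewrite Rmin_left, Rmax_right in Hc by lra.
    replace (1 + 0) with 1 in E by ring. rewrite ln_1 in E.
    assert (0 <= c ^ 2 / (2 * (1 + c) ^ 2)).
    { apply Rle_div_r; nra. }
    replace (0 * (2 + 0) / (2 * 1)) with 0 in E by field.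
    assert (0 <= c ^ 2 / (2 * (1 + c) ^ 2) * (x - 0)) by nra.
    lra.
Qed.

(** The logarithm of [n! / (sqrt n (n / exp 1)^n)]. *)
Definition stirling_error (n : nat) : R :=
  ln (INR (fact n)) - (INR n + 1 / 2) * ln (INR n) + INR n.

Lemma stirling_error_diff (n : nat) : (0 < n)%nat ->
  stirling_error n - stirling_error (S n)
  = (INR n + 1 / 2) * ln (1 + / INR n) - 1.
Proof.
  intros Hn. apply lt_0_INR in Hn.
  unfold stirling_error.
  replace (1 + / INR n) with (INR (S n) / INR n) by (rewrite S_INR; field; lra).
  rewrite fact_simpl, mult_INR, S_INR.
  rewrite ln_mult, ln_div by (try lra; apply lt_0_INR, lt_O_fact).
  ring.
Qed.

(** The sequence decreases from index 1 on, while subtracting [1 / (4n)] makes it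
    increase, so it is bounded below. *)
Lemma ex_lim_stirling_error : exists C : R, is_lim_seq stirling_error C.
Proof.
  assert (D : forall k, 0 <= stirling_error (S k) - stirling_error (S (S k))
     <= / (4 * INR (S k)) - / (4 * INR (S (S k)))).
  { intros k. rewrite stirling_error_diff by lia. rewrite (S_INR (S k)).
    pose proof (lt_0_INR (S k) ltac:(lia)) as Hk.
    set (x := INR (S k)) in *.
    pose proof (Rinv_0_lt_compat x Hk) as Hi.
    pose proof (ln_lower (/ x) ltac:(lra)) as L.
    pose proof (ln_upper (/ x) ltac:(lra)) as U.
    split.
    - apply (Rmult_le_compat_l (x + 1 / 2)) in L; [|lra].
      replace ((x + 1 / 2) * (2 * / x / (2 + / x))) with 1 in L
        by (field; repeat split; lra).
      lra.
    - apply (Rmult_le_compat_l (x + 1 / 2)) in U; [|lra].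
      replace (/ (4 * x) - / (4 * (x + 1))) with
        ((x + 1 / 2) * (/ x * (2 + / x) / (2 * (1 + / x))) - 1)
        by (field; repeat split; lra).
      lra. }
  assert (B : forall k, stirling_error 1 - / 4 <= stirling_error (S k) - / (4 * INR (S k))).
  { induction k as [|k IH]; [cbn [INR]; lra|]. pose proof (D k); lra. }
  destruct (ex_finite_lim_seq_decr (fun k => stirling_error (S k))
              (stirling_error 1 - / 4)) as [C HC].
  - intros k. pose proof (D k); lra.
  - intros k. pose proof (B k).
    assert (0 < / (4 * INR (S k))).
    { apply Rinv_0_lt_compat. pose proof (lt_0_INR (S k) ltac:(lia)); lra. }
    lra.
  - exists C. now apply is_lim_seq_incr_1.
Qed.

Lemma rising_half (m : nat) :
  rising (1 / 2) m * (4 ^ m * INR (fact m)) = INR (fact (2 * m)).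
Proof.
  induction m as [|m IH]; [simpl; lra|].
  replace (2 * S m)%nat with (S (S (2 * m))) by lia.
  rewrite !fact_simpl, !mult_INR, <- IH, !S_INR, mult_INR.
  cbn [rising pow INR]. ring_simplify. field.
Qed.

Lemma rising_thirds (m : nat) :
  rising (1 / 3) m * rising (2 / 3) m * (27 ^ m * INR (fact m)) = INR (fact (3 * m)).
Proof.
  induction m as [|m IH]; [simpl; lra|].
  replace (3 * S m)%nat with (S (S (S (3 * m)))) by lia.
  rewrite !fact_simpl, !mult_INR, <- IH, !S_INR, mult_INR.
  cbn [rising pow INR]. field.
Qed.

(** In the logarithm of [(2m)!^2 27^m / (16^m m! (3m)!)] the powers of m and
    the linear terms cancel, leaving [ln 2 - ln 3 / 2] and the Stirling errors
    in the combination [2 C - C - C = 0]. *)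
Lemma is_lim_seq_rising_ratio :
  is_lim_seq (fun m => rising (1 / 2) m ^ 2 / (rising (1 / 3) m * rising (2 / 3) m))
    (2 / sqrt 3).
Proof.
  destruct ex_lim_stirling_error as [C HC].
  assert (H3 : 0 < sqrt 3) by (apply sqrt_lt_R0; lra).
  apply is_lim_seq_incr_1.
  apply (is_lim_seq_ext (fun k => exp (2 * stirling_error (2 * S k)
     - stirling_error (S k) - stirling_error (3 * S k) + ln (2 / sqrt 3)))).
  - intros k. set (m := S k).
    pose proof (lt_0_INR m ltac:(unfold m; lia)) as Hm.
    clearbody m.
    pose proof (lt_0_INR _ (lt_O_fact m)) as F1.
    pose proof (lt_0_INR _ (lt_O_fact (2 * m))) as F2.
    pose proof (lt_0_INR _ (lt_O_fact (3 * m))) as F3.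
    pose proof (pow_lt 4 m ltac:(lra)) as P4.
    pose proof (pow_lt 27 m ltac:(lra)) as P27.
    replace (rising (1 / 2) m)
      with (INR (fact (2 * m)) / (4 ^ m * INR (fact m)))
      by (rewrite <- rising_half; field; lra).
    replace (rising (1 / 3) m * rising (2 / 3) m)
      with (INR (fact (3 * m)) / (27 ^ m * INR (fact m)))
      by (rewrite <- rising_thirds; field; lra).
    replace ((_ / _) ^ 2 / _) with
      (INR (fact (2 * m)) * INR (fact (2 * m)) * 27 ^ m
       / (4 ^ m * 4 ^ m * INR (fact m) * INR (fact (3 * m))))
      by (field; lra).
    rewrite <- (exp_ln (_ / (4 ^ m * _ * _ * _)))
      by (apply Rdiv_lt_0_compat; repeat apply Rmult_lt_0_compat; assumption).
    f_equal.
    rewrite !ln_div, !ln_mult, !ln_pow by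
      (try lra; repeat apply Rmult_lt_0_compat; assumption).
    replace (ln 4) with (2 * ln 2)
      by (replace 4 with (2 * 2) by ring; rewrite ln_mult; lra).
    replace (ln 27) with (3 * ln 3)
      by (replace 27 with (3 * 3 * 3) by ring; rewrite !ln_mult; lra).
    replace (ln (sqrt 3)) with (ln 3 / 2)
      by (rewrite <- (sqrt_sqrt 3) at 1 by lra; rewrite ln_mult; lra).
    unfold stirling_error. rewrite !mult_INR.
    replace (INR 2) with 2 by (simpl; ring).
    replace (INR 3) with 3 by (simpl; ring).
    rewrite !ln_mult by lra. field.
  - set (L := ln (2 / sqrt 3)).
    replace (2 / sqrt 3) with (exp (2 * C - C - C + L))
      by (unfold L; replace (2 * C - C - C + _) with (ln (2 / sqrt 3)) by ring;
          apply exp_ln, Rdiv_lt_0_compat; lra).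
    apply (is_lim_seq_continuous exp);
      [apply derivable_continuous_pt, derivable_pt_exp|].
    assert (HS : forall q, (0 < q)%nat ->
              is_lim_seq (fun k => stirling_error (q * S k)) C).
    { intros q Hq. apply (is_lim_seq_subseq stirling_error C (fun k => (q * S k)%nat));
        [|exact HC].
      apply eventually_subseq. intros k; nia. }
    apply is_lim_seq_plus'; [|apply is_lim_seq_const].
    repeat apply is_lim_seq_minus'.
    + apply (is_lim_seq_scal_l _ 2 C), HS; lia.
    + now apply is_lim_seq_incr_1 in HC.
    + apply HS; lia.
Qed.

(** * The limit of the first term, and the sum *)

Lemma rising_succ (x : R) (m : nat) :
  x * rising (x + 1) m = rising x m * (x + INR m).
Proof.
  induction m as [|m IH]; [simpl; ring|].
  cbn [rising]. rewrite <- Rmult_assoc, IH, S_INR. ring.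
Qed.

Lemma is_lim_seq_shift_ratio (a b : R) : 0 < b ->
  is_lim_seq (fun m => (INR m + a) / (INR m + b)) 1.
Proof.
  intros Hb.
  apply (is_lim_seq_ext (fun m => 1 + (a - b) * / (INR m + b))).
  { intros m. pose proof (pos_INR m). field; lra. }
  replace 1 with (1 + (a - b) * 0) at 1 by ring.
  apply is_lim_seq_plus'; [apply is_lim_seq_const|].
  apply (is_lim_seq_scal_l _ (a - b) 0).
  apply (is_lim_seq_inv _ p_infty); [|discriminate].
  apply (is_lim_seq_plus _ _ p_infty b);
    [apply is_lim_seq_INR|apply is_lim_seq_const|reflexivity].
Qed.

Lemma summand_head (m : nat) :
  summand 0 m
  = 4 / 9 * (rising (1 / 2) m ^ 2 / (rising (1 / 3) m * rising (2 / 3) m))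
    * ((INR m + 1 / 2) / (INR m + 1 / 3))
    * ((INR m + 1 / 2) / (INR m + 2 / 3))
    * ((INR m + 49 / 36) / (INR m + 4 / 3)).
Proof.
  pose proof (pos_INR m).
  pose proof (rising_pos (1 / 3) m ltac:(lra)).
  pose proof (rising_pos (2 / 3) m ltac:(lra)).
  unfold summand, kernel. rewrite Nat.mul_0_r, Nat.add_0_r. cbn [rising pow INR].
  replace (rising (3 / 2) m) with (2 * (rising (1 / 2) m * (1 / 2 + INR m)))
    by (rewrite <- rising_succ; replace (1 / 2 + 1) with (3 / 2) by lra; lra).
  replace (rising (4 / 3) m) with (3 * (rising (1 / 3) m * (1 / 3 + INR m)))
    by (rewrite <- rising_succ; replace (1 / 3 + 1) with (4 / 3) by lra; lra).
  replace (rising (5 / 3) m) with (3 / 2 * (rising (2 / 3) m * (2 / 3 + INR m)))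
    by (rewrite <- rising_succ; replace (2 / 3 + 1) with (5 / 3) by lra; lra).
  field. repeat split; lra.
Qed.

Lemma is_lim_seq_summand_head :
  is_lim_seq (fun m => summand 0 m) (4 / 9 * (2 / sqrt 3)).
Proof.
  apply (is_lim_seq_ext _ _ _ (fun m => eq_sym (summand_head m))).
  replace (4 / 9 * (2 / sqrt 3)) with (4 / 9 * (2 / sqrt 3) * 1 * 1 * 1) by ring.
  do 3 (apply is_lim_seq_mult'; [|apply is_lim_seq_shift_ratio; lra]).
  apply is_lim_seq_mult'; [apply is_lim_seq_const|apply is_lim_seq_rising_ratio].
Qed.

Lemma Series_summand_0 : Series (fun n => summand n 0) = 4 / 9 * (2 / sqrt 3).
Proof.
  set (s := Series _).
  assert (H : is_lim_seq (fun m => s - summand 0 m) 0).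
  { apply is_lim_seq_abs_0.
    apply (is_lim_seq_le_le (fun _ => 0) _ (fun m => 16 * / (INR m + 1))).
    - intros m. split; [apply Rabs_pos|].
      unfold s. rewrite <- (Series_summand_const m).
      apply Series_summand_near_head.
    - apply is_lim_seq_const.
    - replace (Finite 0) with (Rbar_mult 16 0) by (simpl; f_equal; ring).
      apply is_lim_seq_scal_l.
      apply (is_lim_seq_inv _ p_infty); [|discriminate].
      apply (is_lim_seq_plus _ _ p_infty 1);
        [apply is_lim_seq_INR|apply is_lim_seq_const|reflexivity]. }
  pose proof (is_lim_seq_plus' _ _ _ _ H is_lim_seq_summand_head) as L.
  apply (is_lim_seq_ext _ (fun _ => s)) in L; [|intros m; cbv beta; ring].
  apply is_lim_seq_unique in L. rewrite Lim_seq_const in L.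
  injection L; lra.
Qed.

Theorem mainTheorem12 :
  is_series
    (fun j : nat =>
       (- (1 / 4)) ^ j
       * ((rising (- (1 / 12)) j * rising (5 / 12) j * rising (5 / 6) j)
          / (rising 1 j * rising (5 / 3) j * rising (5 / 3) j))
       * (60 * INR j + 49))
    (256 * sqrt 3 / 9).
Proof.
  apply (is_series_ext (fun j => 96 * summand j 0)).
  { intros j. symmetry. apply term_summand. }
  replace (256 * sqrt 3 / 9) with (96 * Series (fun n => summand n 0)).
  - apply (is_series_scal 96 (fun j => summand j 0)).
    apply Series_correct, ex_series_summand.
  - rewrite Series_summand_0.
    assert (0 < sqrt 3) by (apply sqrt_lt_R0; lra).
    replace (256 * sqrt 3 / 9) with (256 * (sqrt 3 * sqrt 3) / (9 * sqrt 3))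
      by (field; lra).
    rewrite sqrt_sqrt by lra. field; lra.
Qed.
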